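(* Let $(M_1,L_1)\stackrel{J_1}{\leftarrow}(S,\Omega)\stackrel{J_2}{\rightarrow}(M_2,L_2)$ be a full pre-dual pair, and suppose that the characteristic foliations $\mathcal K$ of $\Omega$ and $\mathcal K_i$ of $\Omega_{L_i}$ ($i=1,2$) are simple. Let $\Omega_{\mathrm{red}}$ be the induced symplectic form on $S/\mathcal K$ and let $\pi_i$ be the induced Poisson structure on $M_i/\mathcal K_i$, $i=1,2$. Then the maps $J_i:S\to M_i$ induce surjective submersions on the quotients, $j_i:S/\mathcal K\to M_i/\mathcal K_i$, in such a way that $$(M_1/\mathcal K_1,\pi_1)\stackrel{j_1}{\leftarrow}(S/\mathcal K,\Omega_{\mathrm{red}})\stackrel{j_2}{\rightarrow}(M_2/\mathcal K_2,\pi_2)$$ is a full dual pair.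
   Context: Linear Dirac structures: a Dirac structure on a finite-dimensional real vector space $V$ is a subspace $L\subset V\oplus V^*$ maximally isotropic for the pairing $\langle (x,\omega),(y,\mu)\rangle=\frac12(\omega(y)+\mu(x))$. With $\rho:V\oplus V^*\to V$ the projection, $L$ determines a skew-symmetric bilinear form $\Omega_L$ on $\rho(L)$ by $\Omega_L(x,\cdot)=\eta|_{\rho(L)}$ for any $\eta$ with $(x,\eta)\in L$; its kernel is $\ker\Omega_L=L\cap V$. A skew form $\Omega$ is identified with $v\mapsto\Omega(v,\cdot)$, and $\mathrm{graph}(\Omega)=\{(x,\Omega(x,\cdot))\}$; a bivector $\pi$ is identified with the map $\tilde\pi:V^*\to V$, $\eta(\tilde\pi(\nu))=\pi(\eta,\nu)$, and $\mathrm{graph}(\pi)=\{(\tilde\pi(\nu),\nu)\}$. For a linear map $\phi:V\to W$ put $\mathcal F\phi(L)=\{(\phi(x),\eta): x\in V,\eta\in W^*,(x,\phi^*\eta)\in L\}$. A Dirac structure on a manifold $M$ is a subbundle $L\subset TM\oplus T^*M$ that is a linear Dirac structure at each point and whose sections are closed under the Courant bracket $((X,\omega),(Y,\mu))\mapsto([X,Y],\mathcal L_X\mu-\mathcal L_Y\omega+\frac12 d(\omega(Y)-\mu(X)))$. Poisson structures and closed $2$-forms (pre-symplectic forms) are regarded as Dirac structures through their graphs. A smooth map $\phi:(M,L_M)\to(N,L_N)$ is a Dirac map if $\mathcal F(T_x\phi)((L_M)_x)=(L_N)_{\phi(x)}$ for all $x$. A pre-dual pair consists of a pre-symplectic manifold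 $(S,\Omega)$ (i.e. $\Omega$ is a closed $2$-form), Dirac manifolds $(M_1,L_1),(M_2,L_2)$, and Dirac maps $J_i:S\to M_i$, $i=1,2$ (where $S$ carries the Dirac structure $\mathrm{graph}(\Omega)$), such that for all $x\in S$, $(\ker T_xJ_1)^{\Omega}=\ker T_xJ_2+\ker\Omega$ and $(\ker T_xJ_2)^{\Omega}=\ker T_xJ_1+\ker\Omega$, where $^\Omega$ is the $\Omega$-orthogonal. It is full if each $J_i$ is a surjective submersion. A dual pair consists of a symplectic manifold $(S,\Omega)$, Poisson manifolds $(M_i,\pi_i)$ and Poisson maps $J_i:S\to M_i$, $i=1,2$, with $\ker T_xJ_1=(\ker T_xJ_2)^{\Omega}$ for all $x$. It is full if $J_1,J_2$ are surjective submersions. The characteristic foliation of a Dirac structure $L$ on $M$ (or of a closed 2-form $\Omega$, taking $L=\mathrm{graph}(\Omega)$) is the foliation $\mathcal K$ tangent to $\ker\Omega_L=L\cap TM$. It is simple if $M/\mathcal K$ is a smooth manifold and $\mathrm{pr}:M\to M/\mathcal K$ is a submersion. In that case $M/\mathcal K$ carries a natural induced Poisson structure for which $\mathrm{pr}$ is a Dirac map; for $L=\mathrm{graph}(\Omega)$ this Poisson structure comes from a symplectic form $\Omega_{\mathrm{red}}$ on $S/\mathcal K$ (with $\mathrm{pr}^*\Omega_{\mathrm{red}}=\Omega$). ''Induce on the quotients'' means $j_i\circ\mathrm{pr}=\mathrm{pr}_i\circ J_i$, where $\mathrm{pr}:S\to S/\mathcal K$ and $\mathrm{pr}_i:M_i\to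 M_i/\mathcal K_i$ are the projections. *)

(* Defs.v *)
From HB Require Import structures.
From mathcomp Require Import all_boot all_order all_algebra.
From mathcomp Require Import all_classical all_reals all_analysis.
Set Implicit Arguments.
Unset Strict Implicit.
Unset Printing Implicit Defensive.
Import Order.TTheory GRing.Theory Num.Theory.
Import numFieldNormedType.Exports.
Local Open Scope classical_set_scope.
Local Open Scope ring_scope.

(** * Smooth maps between finite-dimensional normed spaces *)

Section Smooth.
Context {R : realType} {V W : normedModType R}.

(* Meaningful for U open and V finite-dimensional, which is the case in every
   use below. *)
Fixpoint Ck (k : nat) (U : set V) (f : V -> W) : Prop :=
  if k is k'.+1 then
    (forall x, U x -> differentiable f x) /\ (forall v, Ck k' U ('D_v f))
  else forall x, U x -> {for x, continuous f}.

Definition smooth_on (U : set V) (f : V -> W) : Prop := forall k, Ck k U f.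

End Smooth.

(** * Linear algebra

   A vector of V = R^n is a row 'rV_n, a covector is a column 'cV_n, and the
   value of the covector w at v is the scalar v *m w.  A linear map V -> W is
   a matrix T acting on the right, v |-> v *m T, so that T^* is w |-> T *m w.
   The matrix A of a bilinear form is such that Omega(v, w) = v *m A *m w^T;
   the matrix P of a bivector is such that pi(w, z) = w^T *m P *m z. *)

Section Linear.
Context {R : realType}.

Definition ev n (w : 'cV[R]_n) (v : 'rV[R]_n) : R := (v *m w) 0 0.

Definition dirac_pairing n (a b : 'rV[R]_n * 'cV[R]_n) : R :=
  2^-1 * (ev a.2 b.1 + ev b.2 a.1).

Definition isotropic n (L : {vspace 'rV[R]_n * 'cV[R]_n}) : Prop :=
  forall a b, a \in L -> b \in L -> dirac_pairing a b = 0.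

Definition linear_dirac n (L : {vspace 'rV[R]_n * 'cV[R]_n}) : Prop :=
  isotropic L /\
  (forall L' : {vspace 'rV[R]_n * 'cV[R]_n},
     isotropic L' -> (L <= L')%VS -> L' = L).

Definition graph_form n (A : 'M[R]_n) : {vspace 'rV[R]_n * 'cV[R]_n} :=
  limg (linfun (fun v : 'rV[R]_n => (v, (v *m A)^T))).

Definition graph_bivector n (P : 'M[R]_n) : {vspace 'rV[R]_n * 'cV[R]_n} :=
  limg (linfun (fun w : 'cV[R]_n => ((P *m w)^T, w))).

Definition forward m n (T : 'M[R]_(m, n))
    (L : {vspace 'rV[R]_m * 'cV[R]_m}) : set ('rV[R]_n * 'cV[R]_n) :=
  [set p | exists x, x *m T = p.1 /\ (x, T *m p.2) \in L].

(* The kernel L :&: V of the form Omega_L. *)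
Definition char_kernel n (L : {vspace 'rV[R]_n * 'cV[R]_n}) : set 'rV[R]_n :=
  [set v | (v, 0) \in L].

Definition skew n (A : 'M[R]_n) : Prop := A^T = - A.

(* The Omega-orthogonal of the row space of W. *)
Definition orth m n (A : 'M[R]_n) (W : 'M[R]_(m, n)) : 'M[R]_n :=
  kermx (A *m W^T).

End Linear.

(** * Manifolds

   Hausdorff, second countable, of constant dimension n.  The smooth structure
   is given by an atlas containing a designated chart around each point.  The
   tangent space at y is 'rV_n, the coordinates being those of the designated
   chart at y. *)

Record manifold (R : realType) (n : nat) := Manifold {
  mpoint :> topologicalType;
  chart_dom : mpoint -> set mpoint;
  chart : mpoint -> mpoint -> 'rV[R]_n;
  chart_inv : mpoint -> 'rV[R]_n -> mpoint;
  manifold_hausdorff : hausdorff_space mpoint;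
  manifold_second_countable : @second_countable mpoint;
  chart_dom_open : forall x, open (chart_dom x);
  chart_dom_center : forall x, chart_dom x x;
  chart_codom_open : forall x, open (chart x @` chart_dom x);
  chartK : forall x y, chart_dom x y -> chart_inv x (chart x y) = y;
  chart_continuous : forall x y, chart_dom x y ->
    {for y, continuous (chart x)};
  chart_inv_continuous : forall x u, (chart x @` chart_dom x) u ->
    {for u, continuous (chart_inv x)};
  chart_smooth : forall x y,
    smooth_on (chart x @` (chart_dom x `&` chart_dom y))
              (chart y \o chart_inv x)
}.

Section Geometry.
Context {R : realType}.

Section Maps.
Context {m n : nat} {M : manifold R m} {N : manifold R n}.

Definition smooth_map (phi : M -> N) : Prop :=
  continuous phi /\
  forall x y, smooth_on (chart x @` (chart_dom x `&` phi @^-1` chart_dom y))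
                        (chart y \o phi \o chart_inv x).

Definition tangent (phi : M -> N) (x : M) : 'M[R]_(m, n) :=
  'J (chart (phi x) \o phi \o chart_inv x) (chart x x).

Definition surjective_submersion (phi : M -> N) : Prop :=
  [/\ smooth_map phi, forall y, exists x, phi x = y &
      forall x, row_full (tangent phi x)].

End Maps.

Section Tensors.
Context {n : nat} {M : manifold R n}.

(* The differential at y of the chart around x, and its inverse. *)
Definition to_chart (x y : M) : 'M[R]_n :=
  'J (chart x \o chart_inv y) (chart y y).
Definition from_chart (x y : M) : 'M[R]_n :=
  'J (chart y \o chart_inv x) (chart x y).

(* Coordinate expressions in the chart around x. *)
Definition fun_rep (f : M -> R) (x : M) (u : 'rV[R]_n) : R :=
  f (chart_inv x u).
Definition vect_rep (X : M -> 'rV[R]_n) (x : M) (u : 'rV[R]_n) : 'rV[R]_n :=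
  let y := chart_inv x u in X y *m to_chart x y.
Definition covect_rep (w : M -> 'cV[R]_n) (x : M) (u : 'rV[R]_n) : 'cV[R]_n :=
  let y := chart_inv x u in from_chart x y *m w y.
Definition form_rep (Omega : M -> 'M[R]_n) (x : M) (u : 'rV[R]_n) : 'M[R]_n :=
  let y := chart_inv x u in
  from_chart x y *m Omega y *m (from_chart x y)^T.
Definition bivector_rep (pi : M -> 'M[R]_n) (x : M) (u : 'rV[R]_n) :
    'M[R]_n :=
  let y := chart_inv x u in (to_chart x y)^T *m pi y *m to_chart x y.

Definition smooth_rep {W : normedModType R} (U : set M)
    (rep : M -> 'rV[R]_n -> W) : Prop :=
  forall x, smooth_on (chart x @` (chart_dom x `&` U)) (rep x).

(* The operators below are computed at y in the designated chart at y, where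
   to_chart y y = 1. *)
Definition diff_fun (f : M -> R) (y : M) : 'cV[R]_n :=
  \col_j 'D_(delta_mx 0 j) (fun_rep f y) (chart y y).

Definition lie_bracket (X Y : M -> 'rV[R]_n) (y : M) : 'rV[R]_n :=
  'D_(X y) (vect_rep Y y) (chart y y) - 'D_(Y y) (vect_rep X y) (chart y y).

(* (L_X w)(v) = (D_X w)(v) + w (D_v X) in coordinates. *)
Definition lie_derivative (X : M -> 'rV[R]_n) (w : M -> 'cV[R]_n) (y : M) :
    'cV[R]_n :=
  'D_(X y) (covect_rep w y) (chart y y) +
  'J (vect_rep X y) (chart y y) *m w y.

Definition courant_bracket (s t : M -> 'rV[R]_n * 'cV[R]_n) (y : M) :
    'rV[R]_n * 'cV[R]_n :=
  let X z := (s z).1 in let w z := (s z).2 in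
  let Y z := (t z).1 in let mu z := (t z).2 in
  (lie_bracket X Y y,
   lie_derivative X mu y - lie_derivative Y w y +
   2^-1 *: diff_fun (fun z => ev (w z) (Y z) - ev (mu z) (X z)) y).

Definition smooth_section (U : set M) (s : M -> 'rV[R]_n * 'cV[R]_n) : Prop :=
  smooth_rep U (vect_rep (fun z => (s z).1)) /\
  smooth_rep U (covect_rep (fun z => (s z).2)).

(* A smooth local frame around every point. *)
Definition smooth_subbundle (L : M -> {vspace 'rV[R]_n * 'cV[R]_n}) : Prop :=
  forall x, exists (k : nat) (U : set M)
      (e : 'I_k -> M -> 'rV[R]_n * 'cV[R]_n),
    [/\ open U, U x, forall i, smooth_section U (e i) &
        forall y, U y -> basis_of (L y) [seq e i y | i <- enum 'I_k]].

Definition courant_involutive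
    (L : M -> {vspace 'rV[R]_n * 'cV[R]_n}) : Prop :=
  forall s t, smooth_section setT s -> smooth_section setT t ->
    (forall y, s y \in L y) -> (forall y, t y \in L y) ->
    forall y, courant_bracket s t y \in L y.

Definition dirac_structure (L : M -> {vspace 'rV[R]_n * 'cV[R]_n}) : Prop :=
  [/\ forall x, linear_dirac (L x), smooth_subbundle L &
      courant_involutive L].

Definition diff_form (Omega : M -> 'M[R]_n) (y : M) (a b c : 'rV[R]_n) : R :=
  let D v := 'D_v (form_rep Omega y) (chart y y) in
  (b *m D a *m c^T) 0 0 + (c *m D b *m a^T) 0 0 + (a *m D c *m b^T) 0 0.

Definition presymplectic (Omega : M -> 'M[R]_n) : Prop :=
  [/\ forall x, skew (Omega x), smooth_rep setT (form_rep Omega) &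
      forall x a b c, diff_form Omega x a b c = 0].

Definition symplectic (Omega : M -> 'M[R]_n) : Prop :=
  presymplectic Omega /\ forall x, Omega x \in unitmx.

Definition smooth_fun (f : M -> R) : Prop := smooth_rep setT (fun_rep f).

Definition poisson_bracket (pi : M -> 'M[R]_n) (f g : M -> R) (x : M) : R :=
  ((diff_fun f x)^T *m pi x *m diff_fun g x) 0 0.

Definition poisson_structure (pi : M -> 'M[R]_n) : Prop :=
  [/\ forall x, skew (pi x), smooth_rep setT (bivector_rep pi) &
      forall f g h, smooth_fun f -> smooth_fun g -> smooth_fun h ->
      forall x, poisson_bracket pi f (poisson_bracket pi g h) x +
                poisson_bracket pi g (poisson_bracket pi h f) x +
                poisson_bracket pi h (poisson_bracket pi f g) x = 0].

(* The bivector whose graph is the graph of the nondegenerate form Omega. *)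
Definition symplectic_bivector (Omega : M -> 'M[R]_n) (x : M) : 'M[R]_n :=
  (invmx (Omega x))^T.

(* A curve tangent to K; joining by such curves is an equivalence relation
   since a piecewise smooth path can be reparametrized to stop at its
   corners. *)
Definition tangent_curve (K : M -> set 'rV[R]_n) (c : R -> M) : Prop :=
  [/\ continuous c,
      forall x, smooth_on (c @^-1` chart_dom x) (chart x \o c) &
      forall t, K (c t) ('D_1 (chart (c t) \o c) t)].

Definition same_leaf (K : M -> set 'rV[R]_n) (x y : M) : Prop :=
  exists c : R -> M, [/\ tangent_curve K c, c 0 = x & c 1 = y].

End Tensors.

Definition dirac_map m n (M : manifold R m) (N : manifold R n)
    (LM : M -> {vspace 'rV[R]_m * 'cV[R]_m})
    (LN : N -> {vspace 'rV[R]_n * 'cV[R]_n}) (phi : M -> N) : Prop :=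
  smooth_map phi /\
  forall x, forward (tangent phi x) (LM x) = [set p | p \in LN (phi x)].

Definition poisson_map m n (M : manifold R m) (N : manifold R n)
    (piM : M -> 'M[R]_m) (piN : N -> 'M[R]_n) (phi : M -> N) : Prop :=
  smooth_map phi /\
  forall f g, smooth_fun f -> smooth_fun g -> forall x,
    poisson_bracket piM (f \o phi) (g \o phi) x =
    poisson_bracket piN f g (phi x).

(* Q, with projection pr, is the leaf space of the foliation tangent to K,
   and the foliation is simple: the fibres of pr are the leaves, pr is a
   submersion, and the leaves have tangent spaces K. *)
Definition simple_foliation m q (M : manifold R m) (K : M -> set 'rV[R]_m)
    (Q : manifold R q) (pr : M -> Q) : Prop :=
  [/\ surjective_submersion pr,
      forall x y, pr x = pr y <-> same_leaf K x y &
      forall x v, K x v <-> v *m tangent pr x = 0].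

Definition induced_symplectic m q (M : manifold R m) (Q : manifold R q)
    (pr : M -> Q) (Omega : M -> 'M[R]_m) (Omega_red : Q -> 'M[R]_q) : Prop :=
  symplectic Omega_red /\
  forall x, tangent pr x *m Omega_red (pr x) *m (tangent pr x)^T = Omega x.

Definition induced_poisson m q (M : manifold R m) (Q : manifold R q)
    (pr : M -> Q) (L : M -> {vspace 'rV[R]_m * 'cV[R]_m})
    (pi : Q -> 'M[R]_q) : Prop :=
  poisson_structure pi /\ dirac_map L (fun z => graph_bivector (pi z)) pr.

Definition pre_dual_pair s m1 m2 (S : manifold R s)
    (M1 : manifold R m1) (M2 : manifold R m2) (Omega : S -> 'M[R]_s)
    (L1 : M1 -> {vspace 'rV[R]_m1 * 'cV[R]_m1})
    (L2 : M2 -> {vspace 'rV[R]_m2 * 'cV[R]_m2})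
    (J1 : S -> M1) (J2 : S -> M2) : Prop :=
  [/\ presymplectic Omega,
      dirac_structure L1 /\ dirac_structure L2,
      dirac_map (fun x => graph_form (Omega x)) L1 J1,
      dirac_map (fun x => graph_form (Omega x)) L2 J2 &
      forall x,
        (orth (Omega x) (kermx (tangent J1 x)) ==
           kermx (tangent J2 x) + kermx (Omega x))%MS /\
        (orth (Omega x) (kermx (tangent J2 x)) ==
           kermx (tangent J1 x) + kermx (Omega x))%MS].

Definition dual_pair s m1 m2 (S : manifold R s)
    (M1 : manifold R m1) (M2 : manifold R m2) (Omega : S -> 'M[R]_s)
    (pi1 : M1 -> 'M[R]_m1) (pi2 : M2 -> 'M[R]_m2)
    (J1 : S -> M1) (J2 : S -> M2) : Prop :=
  [/\ symplectic Omega,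
      poisson_structure pi1 /\ poisson_structure pi2,
      poisson_map (symplectic_bivector Omega) pi1 J1,
      poisson_map (symplectic_bivector Omega) pi2 J2 &
      forall x, (kermx (tangent J1 x) ==
                   orth (Omega x) (kermx (tangent J2 x)))%MS].

Definition full s m1 m2 (S : manifold R s)
    (M1 : manifold R m1) (M2 : manifold R m2)
    (J1 : S -> M1) (J2 : S -> M2) : Prop :=
  surjective_submersion J1 /\ surjective_submersion J2.

End Geometry.

(* Main.v *)
From HB Require Import structures.
Require Import Defs.
From mathcomp Require Import all_boot all_order all_algebra.
From mathcomp Require Import all_classical all_reals all_analysis.
From mathcomp Require Import lra.
Import Order.TTheory GRing.Theory Num.Theory.
Import numFieldNormedType.Exports.
Local Open Scope classical_set_scope.
Local Open Scope ring_scope.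
Set Implicit Arguments.
Unset Strict Implicit.
Unset Printing Implicit Defensive.

(** The maps [J_i] are forward Dirac maps, so their differentials send the
    kernel of [Omega] into the kernel of [L_i]. A curve in a leaf of [S] is
    therefore mapped to a curve in a leaf of [M_i], and [J_i] descends to a map
    [j_i] with [j_i \o pr = pr_i \o J_i] ([quotient_map_exists]).

    The analytic point is that [j_i] is smooth: around a point of the base, the
    surjective submersion [pr] has a smooth local section, so [j_i] is locally
    [pr_i \o J_i] composed with that section ([submersion_factor_smooth]). The
    section comes from the inverse function theorem for maps of class C^infinity
    between spaces of rows ([local_inverse], [local_section]), proved here with
    the contraction principle. Differentiating [j_i \o pr = pr_i \o J_i] gives
    [T pr *m T j_i = T J_i *m T pr_i], whence [j_i] is a submersion, and it is
    onto because [pr_i] and [J_i] are.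

    What remains is linear algebra at a point. Evaluating the equality of the
    push-forward of [graph Omega] along [pr_i \o J_i] with [graph pi_i] on a
    covector, and using that [Omega] is the pull-back of [Omega_red], shows that
    [T j_i] maps the bivector of [Omega_red] to [pi_i] ([reduced_bivector]);
    with the chain rule for functions this says that [j_i] is a Poisson map.
    Finally
    [ker T j_i] is the image of [ker T J_i] under [T pr] ([reduced_kernel]), and
    the orthogonality relation upstairs, [(ker T J_2)^Omega = ker T J_1 + ker
    Omega], projects to [(ker T j_2)^Omega_red = ker T j_1] ([reduced_orth]). *)

(** * Calculus of C^k maps *)

Section Calculus.
Context {R : realType}.
Implicit Types V W : normedModType R.

(** The definition of the differential with explicit epsilons. *)
Lemma diff_eps V W (f : V -> W) (x : V) :
  differentiable f x ->
  forall e : R, 0 < e ->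
    \forall y \near x, `|f y - f x - 'd f x (y - x)| <= e * `|y - x|.
Proof.
move=> df e e0; have /eqaddoP := diff_locally df.
move=> /(_ e e0) /nbhs_normP [d /= d0 h]; apply/nbhs_normP; exists d => //= y /= yd.
have /= := h (y - x); rewrite sub0r normrN distrC => /(_ yd).
rewrite -[X in `|X| <= _ -> _]/(f (y - x + x) - (f x + 'd f x (y - x))).
by rewrite subrK opprD addrA.
Qed.

(** Conversely, a continuous linear map satisfying this estimate is the
    differential. *)
Lemma eps_diff V W (f : V -> W) (x : V) (df : {linear V -> W}) :
  continuous df ->
  (forall e : R, 0 < e ->
    \forall y \near x, `|f y - f x - df (y - x)| <= e * `|y - x|) ->
  differentiable f x /\ 'd f x = df :> (V -> W).
Proof.
move=> dfc H.
have E : f \o shift x = cst (f x) + df +o_ 0 id.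
  apply/eqaddoP => e e0; have /nbhs_normP [d /= d0 h] := H e e0.
  apply/nbhs_normP; exists d => //= y /= yd.
  have /= := h (y + x); rewrite addrK opprD addrCA subrr addr0 normrN.
  rewrite sub0r normrN in yd => /(_ yd).
  by rewrite -[X in _ -> `|X| <= _]/(f (y + x) - (f x + df y)) opprD addrA.
have U := diff_unique dfc E.
by split=> //; apply/diff_locallyP; split; [move=> u; rewrite U; exact: dfc|rewrite U].
Qed.

Lemma near_differentiable V W (f g : V -> W) (x : V) :
  (\near x, f x = g x) -> differentiable f x -> differentiable g x.
Proof.
move=> fg df; apply: (eps_diff (df := 'd f x) _ _).1.
  exact: diff_continuous.
move=> e e0; near=> y.
rewrite -(nbhs_singleton fg) -(near fg y) //; near: y.
exact: diff_eps.
Unshelve. all: by end_near. Qed.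

Lemma derive_comp (U V W : normedModType R) (f : U -> V) (g : V -> W) x v :
  differentiable f x -> differentiable g (f x) ->
  'D_v (g \o f) x = 'D_('D_v f x) g (f x).
Proof.
move=> df dg; rewrite !deriveE //; last exact: differentiable_comp.
by rewrite diff_comp.
Qed.

Lemma derive_rVE W n (g : 'rV[R]_n -> W) x v : differentiable g x ->
  'D_v g x = \sum_j v 0 j *: 'D_(delta_mx 0 j) g x.
Proof.
move=> dg; rewrite deriveE // {1}(row_sum_delta v) linear_sum.
by apply: eq_bigr => j _; rewrite linearZ deriveE.
Qed.

Lemma Ck_sub V W k (U U' : set V) (f : V -> W) :
  U `<=` U' -> Ck k U' f -> Ck k U f.
Proof.
move=> UU'; elim: k f => [|k IH] f /=; first by move=> h x /UU' /h.
by case=> h1 h2; split=> [x /UU' /h1 //|v]; apply: IH.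
Qed.

Lemma CkS V W k (U : set V) (f : V -> W) : Ck k.+1 U f -> Ck k U f.
Proof.
elim: k f => [|k IH] f.
  by case=> h _ x Ux; apply/differentiable_continuous/h.
by case=> h1 h2; split=> // v; apply: IH; exact: h2.
Qed.

(** [Ck k U f] only depends on the values of [f] on [U] because [U] is open:
    the derivatives that occur in it are then determined on [U] as well. *)
Lemma Ck_eq V W k (U : set V) (f g : V -> W) : open U ->
  (forall x, U x -> f x = g x) -> Ck k U f -> Ck k U g.
Proof.
move=> oU; elim: k f g => [|k IH] f g fg /=.
  move=> fc x Ux; rewrite /prop_for /continuous_at -(fg _ Ux).
  apply: cvg_trans (fc x Ux); apply: near_eq_cvg.
  by near=> y; apply: fg; near: y; exact: open_nbhs_nbhs.
have near_fg x : U x -> \near x, f x = g x.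
  by move=> Ux; near=> y; apply: fg; near: y; exact: open_nbhs_nbhs.
case=> h1 h2; split=> [x Ux|v].
  by apply: near_differentiable (h1 x Ux); exact: near_fg.
by apply: IH (h2 v) => x Ux; apply: near_eq_derive; exact: near_fg.
Unshelve. all: by end_near. Qed.

(** The sets [A] need not be open, since [Ck k A f] already speaks of the
    behaviour of [f] in neighbourhoods of the points of [A]. *)
Lemma Ck_local V W k (U : set V) (f : V -> W) :
  (forall x, U x -> exists A, A x /\ Ck k A f) -> Ck k U f.
Proof.
elim: k f => [|k IH] f h /=.
  by move=> x /h [A [Ax]]; apply.
split=> [x Ux|v].
  by have [A [Ax [fA _]]] := h x Ux; apply: fA.
by apply: IH => x /h [A [Ax [_ fA]]]; exists A; split=> //; exact: fA.
Qed.

Lemma Ck_cst V W k (U : set V) (c : W) : Ck k U (cst c).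
Proof.
elim: k c => [|k IH] c /=; first by move=> x _; exact: cst_continuous.
split=> [x _|v]; first exact: differentiable_cst.
have -> : 'D_v (cst c) = cst (0 : W) :> (V -> W).
  by apply/funext => x; rewrite derive_cst.
exact: IH.
Qed.

Lemma CkD V W k (U : set V) (f g : V -> W) : open U ->
  Ck k U f -> Ck k U g -> Ck k U (fun x => f x + g x).
Proof.
move=> oU; elim: k f g => [|k IH] f g /=.
  by move=> h1 h2 x Ux; apply: continuousD; [exact: h1|exact: h2].
move=> [f1 f2] [g1 g2]; split=> [x Ux|v].
  by apply: differentiableD; [exact: f1|exact: g1].
apply: (@Ck_eq _ _ _ _ (fun x => 'D_v f x + 'D_v g x)) => //; last exact: IH.
by move=> x Ux; rewrite deriveD //; apply: diff_derivable; [exact: f1|exact: g1].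
Qed.

Lemma CkM V k (U : set V) (f g : V -> R) : open U ->
  Ck k U f -> Ck k U g -> Ck k U (fun x => f x * g x).
Proof.
move=> oU; elim: k f g => [|k IH] f g.
  by move=> h1 h2 x Ux; apply: continuousM; [exact: h1|exact: h2].
move=> hf hg; have [f1 f2] := hf; have [g1 g2] := hg; split=> [x Ux|v].
  by apply: differentiableM; [exact: f1|exact: g1].
apply: (@Ck_eq _ _ _ _ (fun x => f x * 'D_v g x + g x * 'D_v f x)) => //.
  by move=> x Ux; rewrite deriveM //; apply: diff_derivable; [exact: f1|exact: g1].
by apply: CkD => //; apply: IH; [exact: CkS|exact: g2|exact: CkS|exact: f2].
Qed.

Lemma Ck_sum V W k (U : set V) (I : Type) (r : seq I) (P : pred I)
    (f : I -> V -> W) : open U ->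
  (forall i, Ck k U (f i)) -> Ck k U (fun x => \sum_(i <- r | P i) f i x).
Proof.
move=> oU h; elim: r => [|i r IH].
  by under eq_fun do rewrite big_nil; exact: Ck_cst.
under eq_fun do rewrite big_cons; case: (P i) => //.
exact: CkD.
Qed.

Lemma Ck_prod V k (U : set V) (I : Type) (r : seq I) (P : pred I)
    (f : I -> V -> R) : open U ->
  (forall i, Ck k U (f i)) -> Ck k U (fun x => \prod_(i <- r | P i) f i x).
Proof.
move=> oU h; elim: r => [|i r IH].
  by under eq_fun do rewrite big_nil; exact: Ck_cst.
under eq_fun do rewrite big_cons; case: (P i) => //.
exact: CkM.
Qed.

Lemma CkV V k (U : set V) (f : V -> R) : open U ->
  (forall x, U x -> f x != 0) -> Ck k U f -> Ck k U (fun x => (f x)^-1).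
Proof.
move=> oU f0; elim: k => [|k IH].
  by move=> h x Ux; apply: continuousV; [exact: f0|exact: h].
move=> hf; have [f1 f2] := hf; split=> [x Ux|v].
  by apply: differentiableV; [exact: f1|exact: f0].
apply: (@Ck_eq _ _ _ _ (fun x => (-1) * ((f x)^-1 * (f x)^-1 * 'D_v f x))) => //.
  move=> x Ux; rewrite deriveV; [|exact: f0|by apply: diff_derivable; exact: f1].
  by rewrite /GRing.scale /= mulN1r mulNr -expr2 exprVn.
apply: CkM => //; first exact: Ck_cst.
apply: CkM => //; last exact: f2.
by apply: CkM => //; apply: IH; exact: CkS.
Qed.

End Calculus.

Section CalculusCoordinates.
Context {R : realType}.
Implicit Types V W : normedModType R.

Lemma CkZl V W k (U : set V) (a : V -> R) (w : W) : open U ->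
  Ck k U a -> Ck k U (fun x => a x *: w).
Proof.
move=> oU; elim: k a => [|k IH] a /=.
  by move=> h x Ux; apply: continuousZr_tmp; exact: h.
move=> [a1 a2]; split=> [x Ux|v].
  by apply: differentiableZl; exact: a1.
apply: (@Ck_eq _ _ _ _ _ (fun x => 'D_v a x *: w)) => //; last exact: IH.
move=> x Ux; rewrite !deriveE; [|apply: differentiableZl; exact: a1|exact: a1].
by rewrite diffZl //; exact: a1.
Qed.

Lemma Ck_coord V n k (U : set V) (f : V -> 'rV[R]_n) : open U ->
  Ck k U f <-> forall j, Ck k U (fun x => f x 0 j).
Proof.
move=> oU; split=> [|h].
  move=> + j; elim: k f => [|k IH] f /=.
    move=> h x Ux; apply: (@continuous_comp _ _ _ f (fun w => w 0 j)).
      exact: h.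
    exact: coord_continuous.
  move=> [f1 f2]; split=> [x Ux|v].
    apply: (@differentiable_comp _ _ _ _ f (fun w => w 0 j)); first exact: f1.
    exact: differentiable_coord.
  apply: (@Ck_eq _ _ _ _ _ (fun x => 'D_v f x 0 j)) => //; last exact: IH.
  move=> x Ux; rewrite derive_mx ?mxE //; apply: diff_derivable; exact: f1.
have -> : f = fun x => \sum_j f x 0 j *: delta_mx 0 j.
  by apply/funext => x; exact: row_sum_delta.
by apply: Ck_sum => // j; exact: CkZl.
Qed.

(** The derivative of [h \o f] along [v] is the sum over [j] of
    [('D_v f)_j * ('D_e_j h \o f)], to which the induction hypothesis applies;
    this reduces to scalar-valued [h], for which products are available. *)
Lemma Ck_comp V n p k (U : set V) (A : set 'rV[R]_n)
    (f : V -> 'rV[R]_n) (g : 'rV[R]_n -> 'rV[R]_p) :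
  open U -> open A -> (forall x, U x -> A (f x)) ->
  Ck k U f -> Ck k A g -> Ck k U (g \o f).
Proof.
move=> oU oA fUA.
suff comp1 (h : 'rV[R]_n -> R) : Ck k U f -> Ck k A h -> Ck k U (h \o f).
  move=> hf /Ck_coord hg; apply/Ck_coord => // j.
  by apply: (comp1 (fun x => g x 0 j)) => //; exact: hg.
elim: k h => [|k IH] h hf hh.
  by move=> x Ux; apply: continuous_comp; [exact: hf|exact/hh/fUA].
have [f1 f2] := hf; have [h1 h2] := hh; split=> [x Ux|v].
  by apply: (@differentiable_comp _ _ _ _ f h); [exact: f1|exact/h1/fUA].
apply: (@Ck_eq _ _ _ _ _ (fun x => \sum_j 'D_v f x 0 j *
    ('D_(delta_mx 0 j) h \o f) x)) => //.
  move=> x Ux; rewrite (derive_comp _ (f1 _ Ux) (h1 _ (fUA _ Ux))).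
  by rewrite (derive_rVE ('D_v f x)) //; exact/h1/fUA.
apply: Ck_sum => // j; apply: CkM => //.
  by have /Ck_coord := f2 v; apply.
by apply: IH; [exact: CkS|exact: h2].
Qed.

Lemma smooth_comp V n p (U : set V) (A : set 'rV[R]_n)
    (f : V -> 'rV[R]_n) (g : 'rV[R]_n -> 'rV[R]_p) :
  open U -> open A -> (forall x, U x -> A (f x)) ->
  smooth_on U f -> smooth_on A g -> smooth_on U (g \o f).
Proof. by move=> oU oA fUA hf hg k; apply: (Ck_comp oU oA). Qed.

Lemma smooth_sub V W (U U' : set V) (f : V -> W) :
  U `<=` U' -> smooth_on U' f -> smooth_on U f.
Proof. by move=> UU' h k; apply: Ck_sub (h k). Qed.

Lemma smooth_eq V W (U : set V) (f g : V -> W) : open U ->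
  (forall x, U x -> f x = g x) -> smooth_on U f -> smooth_on U g.
Proof. by move=> oU fg h k; apply: Ck_eq (h k). Qed.

Lemma smooth_local V W (U : set V) (f : V -> W) :
  (forall x, U x -> exists A, A x /\ smooth_on A f) -> smooth_on U f.
Proof. by move=> h k; apply: Ck_local => x /h [A [Ax fA]]; exists A. Qed.

Lemma smooth_differentiable V W (U : set V) (f : V -> W) x :
  smooth_on U f -> U x -> differentiable f x.
Proof. by move=> /(_ 1) [h _] Ux; exact: h. Qed.

Lemma smooth_affine m n (U : set 'rV[R]_m) (a : 'rV[R]_n) (B : 'M[R]_(m, n)) :
  open U -> smooth_on U (fun u => a + u *m B).
Proof.
move=> oU k; apply: CkD => //; first exact: Ck_cst.
have -> : (fun u : 'rV[R]_m => u *m B) = fun u => \sum_i u 0 i *: row i B.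
  by apply/funext => u; rewrite mulmx_sum_row.
apply: Ck_sum => // i; apply: CkZl => //.
elim: k => [|k _] /=; first by move=> x _; exact: coord_continuous.
split=> [x _|v]; first exact: differentiable_coord.
apply: (@Ck_eq _ _ _ _ _ (cst (v 0 i))) => //; last exact: Ck_cst.
move=> x _; have := derive_mx (@derivable_id _ _ x v).
by rewrite derive_id => /matrixP /(_ 0 i); rewrite mxE => <-.
Qed.

Lemma mulmx_jacobian m n (f : 'rV[R]_m -> 'rV[R]_n) x v :
  differentiable f x -> v *m 'J f x = 'D_v f x.
Proof. by move=> df; rewrite (deriveEjacobian v df). Qed.

Lemma row_jacobian m n (f : 'rV[R]_m -> 'rV[R]_n) x i :
  differentiable f x -> row i ('J f x) = 'D_(delta_mx 0 i) f x.
Proof. by move=> df; rewrite rowE mulmx_jacobian. Qed.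

Lemma jacobian_comp m n p (f : 'rV[R]_m -> 'rV[R]_n) (g : 'rV[R]_n -> 'rV[R]_p) x :
  differentiable f x -> differentiable g (f x) ->
  'J (g \o f) x = 'J f x *m 'J g (f x).
Proof.
move=> df dg; apply/row_matrixP => i; rewrite row_mul (row_jacobian _ df).
rewrite (mulmx_jacobian _ dg) -(derive_comp _ df dg).
exact: row_jacobian (differentiable_comp df dg).
Qed.

Lemma near_jacobian m n (f g : 'rV[R]_m -> 'rV[R]_n) x :
  (\near x, f x = g x) -> differentiable f x -> 'J f x = 'J g x.
Proof.
move=> fg df; have dg : differentiable g x by exact: near_differentiable fg df.
apply/row_matrixP => i; apply: (etrans (row_jacobian i df)).
apply: etrans (esym (row_jacobian i dg)); exact: near_eq_derive.
Qed.

Lemma continuous_mulmxr m n (B : 'M[R]_(m, n)) :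
  continuous (fun u : 'rV[R]_m => u *m B).
Proof.
move=> v; have := smooth_affine 0 B (@openT 'rV[R]_m) 0.
move=> /(_ v I); rewrite /prop_for /continuous_at add0r.
by under eq_fun do rewrite add0r.
Qed.

Lemma derive_affine m n (a : 'rV[R]_n) (B : 'M[R]_(m, n)) x v :
  'D_v (fun u : 'rV[R]_m => a + u *m B) x = v *m B.
Proof.
have [||d dE] := @eps_diff R _ _ (fun u => a + u *m B) x (mulmxr B).
- exact: continuous_mulmxr.
- move=> e e0; apply: (@filterE _ (nbhs x) (nbhs_filter x)) => y /=.
  rewrite mulmxBl opprD addrACA subrr add0r subrr normr0.
  by rewrite mulr_ge0 // ltW.
by rewrite deriveE // dE.
Qed.

End CalculusCoordinates.

(** * The inverse function theorem *)

(** Matrices are complete as a uniform space and form a normed module; this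
    declares the join of the two structures. *)
HB.instance Definition _ (R : realType) (m n : nat) := Complete.on 'M[R]_(m, n).

Section InverseFunction.
Context {R : realType}.

Lemma normr_rV_le n (v : 'rV[R]_n) (c : R) : 0 <= c ->
  (forall j, `|v 0 j| <= c) -> `|v| <= c.
Proof.
move=> c0 h; rewrite /Num.Def.normr /= mx_normrE.
by apply: bigmax_le => // -[i j] _; rewrite (ord1 i).
Qed.

Lemma normr_coord_le n (v : 'rV[R]_n) j : `|v 0 j| <= `|v|.
Proof.
rewrite [leRHS]/Num.Def.normr /= mx_normrE.
by apply: le_trans (le_bigmax _ _ (0, j)).
Qed.

(** The mean value inequality on the segment from [w] to [w + d]. As the norm of
    a row is the maximum of its entries, the one-variable mean value theorem can
    be applied to each entry separately. *)
Lemma mean_value_le (V : normedModType R) n (f : V -> 'rV[R]_n) (w d : V)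
    (c : R) :
  (forall t : R, 0 <= t <= 1 -> differentiable f (w + t *: d)) ->
  (forall t : R, 0 <= t <= 1 -> `|'D_d f (w + t *: d)| <= c) ->
  `|f (w + d) - f w| <= c.
Proof.
move=> df Df.
have c0 : 0 <= c by apply: le_trans (Df 0 _) => //; rewrite lexx ler01.
apply: normr_rV_le => // j.
pose l (t : R) := w + t *: d.
have dl (t : R) : differentiable l t.
  by apply: differentiableD => //; exact: differentiableZl.
have Dl (t : R) : 'D_1 l t = d.
  rewrite deriveD ?derive_cst ?add0r; [|exact: derivable_cst|].
    rewrite deriveE; last exact: differentiableZl.
    by rewrite diffZl //= diff_val scale1r.
  by apply: diff_derivable; exact: differentiableZl.
pose g (t : R) : R := f (l t) 0 j.
have dg (t : R) : 0 <= t <= 1 -> differentiable g t.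
  move=> t01; apply: (@differentiable_comp _ _ _ _ (f \o l) (fun w => w 0 j)).
    exact: (differentiable_comp (dl t) (df t t01)).
  exact: differentiable_coord.
have Dg (t : R) : 0 <= t <= 1 -> 'D_1 g t = 'D_d f (l t) 0 j.
  move=> t01; rewrite -(Dl t) -(derive_comp _ (dl t) (df t t01)).
  rewrite derive_mx ?mxE //.
  by apply: diff_derivable; exact: (differentiable_comp (dl t) (df t t01)).
have [|||t t01] := @MVT R g ('D_1 g) 0 1.
- exact: ltr01.
- move=> x /[!in_itv] /= /andP [x0 x1]; apply: derivableP; apply: diff_derivable.
  by apply: dg; rewrite !ltW.
- apply: derivable_within_continuous => x /[!in_itv] /= x01.
  by apply: diff_derivable; exact: dg.
move: t01; rewrite in_itv /= => /andP [t0 t1].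
have t01 : 0 <= t <= 1 by rewrite !ltW.
rewrite /g /l scale1r scale0r addr0 subr0 mulr1 !mxE => ->.
rewrite -/l -/g Dg //; apply: le_trans (Df t t01); exact: normr_coord_le.
Qed.

Lemma Ck_det (V : normedModType R) n k (U : set V) (N : V -> 'M[R]_n) :
  open U -> (forall i j, Ck k U (fun x => N x i j)) ->
  Ck k U (fun x => \det (N x)).
Proof.
move=> oU h; apply: Ck_sum => // s; apply: CkM => //; first exact: Ck_cst.
exact: Ck_prod.
Qed.

(** By Cramer's rule the entries of the inverse are rational functions of the
    entries of [N]. *)
Lemma Ck_invmx (V : normedModType R) n k (U : set V) (N : V -> 'M[R]_n) i j :
  open U -> (forall x, U x -> N x \in unitmx) ->
  (forall i j, Ck k U (fun x => N x i j)) ->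
  Ck k U (fun x => invmx (N x) i j).
Proof.
move=> oU uN h.
apply: (@Ck_eq _ _ _ _ _ (fun x => (\det (N x))^-1 * cofactor (N x) j i)) => //.
  by move=> x Ux; rewrite /invmx uN // !mxE.
apply: CkM => //.
  apply: CkV => //; last exact: Ck_det.
  by move=> x /uN; rewrite unitmxE unitfE.
apply: CkM => //; first exact: Ck_cst.
by apply: Ck_det => // a b; under eq_fun do rewrite !mxE.
Qed.

End InverseFunction.

(** The inverse function theorem at [0], normalized so that the differential of
    [G] there is the identity. *)
Section LocalInverse.
Context {R : realType} {q : nat}.
Variables (U : set 'rV[R]_q) (G : 'rV[R]_q -> 'rV[R]_q).
Hypotheses (oU : open U) (sG : smooth_on U G) (U0 : U 0).
Hypothesis JG : forall v, 'D_v G 0 = v.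

Let dG u : U u -> differentiable G u.
Proof. exact: smooth_differentiable. Qed.

Lemma near_identity : exists2 r : R, 0 < r & forall u, `|u| <= r ->
  U u /\ forall v, `|v - 'D_v G u| <= 2^-1 * `|v|.
Proof.
(* q.+1 rather than q keeps the bound meaningful when q = 0. *)
pose e : R := (2 * q.+1%:R)^-1.
have e0 : 0 < e by rewrite invr_gt0 mulr_gt0 // ltr0n.
have nU : \forall u \near (0 : 'rV[R]_q), U u by exact: open_nbhs_nbhs.
pose P (j : 'I_q) u := `|delta_mx 0 j - 'D_(delta_mx 0 j) G u| < e.
have nD : \forall u \near (0 : 'rV[R]_q), forall j, P j u.
  apply: (@filter_forall _ _ P (nbhs (0 : 'rV[R]_q)) _) => j.
  have [_ /(_ (delta_mx 0 j)) /= /(_ 0 U0)] := sG 1.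
  by rewrite /prop_for /continuous_at JG => /cvgrPdist_lt; apply.
have nUD : \forall u \near (0 : 'rV[R]_q), U u /\ forall j, P j u.
  exact: (filterI nU nD).
have /nbhs_normP [r /= r0 h] := nUD.
exists (r / 2); first by rewrite divr_gt0.
move=> u ur; have [|Uu Du] := h u.
  rewrite /= sub0r normrN; apply: le_lt_trans ur _.
  by rewrite ltr_pdivrMr // ltr_pMr // ltr1n.
split=> // v; rewrite {1}(row_sum_delta v) (derive_rVE v (dG Uu)) -sumrB.
under eq_bigr do rewrite -scalerBr.
apply: le_trans (ler_norm_sum _ _ _) _.
apply: (@le_trans _ _ (\sum_(j < q) `|v| * e)).
  apply: ler_sum => j _; rewrite normrZ; apply: ler_pM => //.
    exact: normr_coord_le.
  exact/ltW/Du.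
rewrite sumr_const card_ord -[leLHS]mulr_natr -mulrA [leRHS]mulrC.
apply: ler_wpM2l => //; rewrite /e invfM -mulrA ler_piMr ?invr_ge0 //.
by rewrite mulrC ler_pdivrMr ?ltr0n // mul1r ler_nat.
Qed.

(** The value [h y] is the fixed point of the contraction [u |-> u - G u + y].
    The estimate [`|v| <= 2 * `|v *m 'J G u|] near [0] makes the Jacobian
    invertible and bounds its inverse, which gives differentiability of [h] with
    ['D_v h y = v *m invmx ('J G (h y))]; smoothness follows by bootstrapping on
    this formula. *)
Theorem local_inverse : exists (A : set 'rV[R]_q) (h : 'rV[R]_q -> 'rV[R]_q),
  [/\ open A, A (G 0), smooth_on A h, h (G 0) = 0 &
      forall y, A y -> U (h y) /\ G (h y) = y].
Proof.
have [r r0 hr] := near_identity.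
have r20 : 0 < r / 2 by rewrite divr_gt0.
(* u |-> u - G u is a contraction of ratio 1/2 on the ball of radius r. *)
have contr u w : `|u| <= r -> `|w| <= r ->
    `|(u - G u) - (w - G w)| <= 2^-1 * `|u - w|.
  move=> ur wr.
  have seg t : 0 <= t <= 1 -> `|w + t *: (u - w)| <= r.
    move=> /andP [t0 t1].
    have -> : w + t *: (u - w) = (1 - t) *: w + t *: u.
      by rewrite scalerBr scalerBl scale1r addrCA addrC.
    apply: le_trans (ler_normD _ _) _; rewrite !normrZ.
    rewrite (ger0_norm t0) ger0_norm ?subr_ge0 //.
    have : (1 - t) * `|w| + t * `|u| <= (1 - t) * r + t * r.
      by apply: lerD; apply: ler_wpM2l => //; rewrite subr_ge0.
    by rewrite -mulrDl subrK mul1r.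
  have := @mean_value_le R 'rV[R]_q q (fun z => z - G z) w (u - w)
    (2^-1 * `|u - w|).
  rewrite [w + (u - w)]addrC subrK; apply=> t /seg /hr [Ut Dt].
    by apply: differentiableB => //; exact: dG.
  rewrite deriveB ?derive_id //; exact: diff_derivable (dG Ut).
(* Hence G shrinks distances by at most a factor 2 on that ball. *)
have bilip u w : `|u| <= r -> `|w| <= r -> `|u - w| <= 2 * `|G u - G w|.
  move=> ur wr; have := contr u w ur wr.
  have := ler_normD (u - G u - (w - G w)) (G u - G w).
  have -> : u - G u - (w - G w) + (G u - G w) = u - w.
    by rewrite opprB addrAC !addrA !subrK.
  lra.
(* Fixed points of u |-> u - G u + y solve G u = y. *)
have solve y : `|G 0 - y| < r / 2 -> exists u, `|u| <= r /\ G u = y.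
  move=> yb; pose T u := u - G u + y.
  pose B := [set u : 'rV[R]_q | `|u| <= r].
  have TB : {homo T : x / B x >-> B x}.
    move=> u; rewrite /B /= => ur; have := contr u 0 ur; rewrite normr0 => /(_ (ltW r0)).
    have := ler_normD (u - G u - (0 - G 0)) (y - G 0).
    rewrite /T sub0r opprK subr0.
    have -> : u - G u + G 0 + (y - G 0) = u - G u + y.
      by rewrite -addrA [G 0 + _]addrC subrK.
    rewrite distrC in yb; move=> h1 h2; move: ur h1 h2 yb; lra.
  pose f : {fun B >-> B} := HB.pack T (isFun.Build _ _ B B T TB).
  have [||| p Bp pE] := @banach_fixed_point R 'rV[R]_q B f.
  - exists (2^-1)%:nng; split => /=; first by rewrite invf_lt1 ?ltr1n.
    move=> [u w] [/= ur wr]; rewrite /T opprD addrACA subrr addr0.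
    exact: contr.
  - have -> : B = (fun u : 'rV[R]_q => `|u|) @^-1` [set x | x <= r] by [].
    apply: closed_comp; last exact: closed_le.
    by move=> ? _; exact: norm_continuous.
  - by exists 0; rewrite /B /= normr0 ltW.
  exists p; split=> //; move: pE; rewrite /= /T -[LHS]addr0 -addrA.
  by move=> /addrI /eqP; rewrite eq_sym addrC subr_eq0 => /eqP.
pose A := [set y | `|G 0 - y| < r / 2].
have oA : open A.
  rewrite (_ : A = ball (G 0) (r / 2)); first exact: ball_open.
  by rewrite -ball_normE.
have [h hP] : exists h, forall y, A y -> `|h y| <= r /\ G (h y) = y.
  have /choice [h hP] : forall y, exists u, A y -> `|u| <= r /\ G u = y.
    move=> y; have [/solve [u hu]|nA] := pselect (A y); first by exists u.
    by exists 0.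
  by exists h.
have lip y z : A y -> A z -> `|h y - h z| <= 2 * `|y - z|.
  move=> /hP [hy yE] /hP [hz zE]; rewrite -[in leRHS]yE -[in leRHS]zE.
  exact: bilip.
have Uh y : A y -> U (h y) by move=> /hP [/hr [+ _] _].
pose N y := 'J G (h y).
have N_expand y (v : 'rV[R]_q) : A y -> `|v| <= 2 * `|v *m N y|.
  move=> Ay; rewrite /N (mulmx_jacobian _ (dG (Uh _ Ay))).
  have [/hr [_ Dv] _] := hP _ Ay.
  have := ler_normD (v - 'D_v G (h y)) ('D_v G (h y)); rewrite subrK.
  by have := Dv v; lra.
have N_unit y : A y -> N y \in unitmx.
  move=> Ay; rewrite -row_free_unit -kermx_eq0; apply/rowV0P => v /sub_kermxP vN.
  have := N_expand y v Ay; rewrite vN normr0 mulr0 normr_le0.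
  by move/eqP.
have hdiff y : A y -> differentiable h y /\ 'd h y = mulmxr (invmx (N y)) :> (_ -> _).
  move=> Ay; apply: eps_diff.
    exact: continuous_mulmxr.
  move=> e e0.
  have nA : nbhs y A by exact: open_nbhs_nbhs.
  have hc : {for y, continuous h}.
    apply/(@cvgrPdist_lt _ _ _ (nbhs y) (nbhs_filter y)) => d d0.
    have yd : \forall z \near y, `|y - z| < d / 2.
      by apply/nbhs_normP; exists (d / 2); rewrite //= divr_gt0.
    apply: filterS2 nA yd => z Az yzd; apply: le_lt_trans (lip y z Ay Az) _.
    by rewrite mulrC -ltr_pdivlMr.
  have e40 : 0 < e / 4 by rewrite divr_gt0.
  have := diff_eps (dG (Uh _ Ay)) e40 => /hc /= near_eps.
  apply: filterS2 nA near_eps => z Az.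
  have [_ yE] := hP _ Ay; have [_ zE] := hP _ Az.
  rewrite /= -(deriveE _ (dG (Uh _ Ay))).
  rewrite -(mulmx_jacobian _ (dG (Uh _ Ay))) -/(N y) yE zE => main.
  rewrite /mulmxr /=.
  apply: le_trans (N_expand y _ Ay) _.
  rewrite mulmxBl mulmxKV ?N_unit // -normrN opprB.
  have := lip z y Az Ay.
  have : e / 4 * `|h z - h y| <= e / 4 * (2 * `|z - y|).
    by rewrite ler_pM2l //; exact: lip.
  move: main; lra.
exists A, h; split=> //.
- by rewrite /A /= subrr normr0.
- have hD v y : A y -> 'D_v h y = v *m invmx (N y).
    by move=> /hdiff [dh dE]; rewrite deriveE // dE.
  elim=> [|k IH] /=.
    by move=> y /hdiff [dh _]; exact: differentiable_continuous.
  split=> [y /hdiff [] //|v]; apply/Ck_coord => // j.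
  apply: (@Ck_eq _ _ _ _ _ (fun y => \sum_i v 0 i * invmx (N y) i j)) => //.
    by move=> y Ay; rewrite hD // mxE.
  apply: Ck_sum => // i; apply: CkM => //; first exact: Ck_cst.
  apply: Ck_invmx => // a b.
  apply: (@Ck_eq _ _ _ _ _ (fun y => ('D_(delta_mx 0 a) G \o h) y 0 b)) => //.
    move=> y Ay /=; rewrite -(row_jacobian a (dG (Uh _ Ay))).
    by rewrite mxE.
  have sDG : Ck k U ('D_(delta_mx 0 a) G) by have [_] := sG k.+1; apply.
  by have /Ck_coord := Ck_comp oA oU Uh IH sDG; apply.
- have A0 : A (G 0) by rewrite /A /= subrr normr0.
  have [hr0 hE] := hP _ A0; have := bilip (h (G 0)) 0 hr0.
  rewrite normr0 hE subrr normr0 mulr0 subr0 => /(_ (ltW r0)).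
  by rewrite normr_le0 => /eqP.
by move=> y Ay; split; [exact: Uh|have [] := hP _ Ay].
Qed.

End LocalInverse.

(** * Germs of smooth maps and local sections *)

Section SmoothNear.
Context {R : realType}.
Implicit Types V W : normedModType R.

(** [f] is smooth in some neighbourhood of [a]. *)
Definition smooth_near V W (f : V -> W) (a : V) : Prop :=
  exists A : set V, [/\ open A, A a & smooth_on A f].

Lemma smooth_near_differentiable V W (f : V -> W) a :
  smooth_near f a -> differentiable f a.
Proof. by move=> [A [_ Aa sf]]; exact: smooth_differentiable sf Aa. Qed.

Lemma smooth_near_continuous V W (f : V -> W) a :
  smooth_near f a -> {for a, continuous f}.
Proof.
by move=> /smooth_near_differentiable; exact: differentiable_continuous.
Qed.

Lemma smooth_near_comp V n p (f : V -> 'rV[R]_n) (g : 'rV[R]_n -> 'rV[R]_p) a :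
  smooth_near f a -> smooth_near g (f a) -> smooth_near (g \o f) a.
Proof.
move=> [A [oA Aa sf]] [B [oB Ba sg]].
have oC : open (A `&` f @^-1` B).
  rewrite openE => x [Ax Bfx]; apply: filterI; first exact: open_nbhs_nbhs.
  have fx : {for x, continuous f} by exact: sf 0%N x Ax.
  by apply: fx; exact: open_nbhs_nbhs.
exists (A `&` f @^-1` B); split=> //.
apply: (smooth_comp oC oB) => //; first by move=> x [].
by apply: smooth_sub sf => x [].
Qed.

Lemma smooth_near_eq V W (f g : V -> W) a :
  (\near a, f a = g a) -> smooth_near f a -> smooth_near g a.
Proof.
move=> fg [A [oA Aa sf]].
pose B := [set x | f x = g x]°.
have oB : open B by exact: open_interior.
have Ba : B a by exact: fg.
exists (A `&` B); split=> //; first exact: openI.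
apply: (@smooth_eq _ _ _ _ f); first exact: openI.
  by move=> x [_ /nbhs_singleton]; exact.
by apply: smooth_sub sf => x [].
Qed.

Lemma smooth_near_on V W (U : set V) (f : V -> W) :
  (forall x, U x -> smooth_near f x) -> smooth_on U f.
Proof.
by move=> h; apply: smooth_local => x /h [A [oA Ax sf]]; exists A.
Qed.

(** A map whose Jacobian at [a] has rank equal to the dimension of the target
    has a smooth local right inverse [H] through [a]: restrict [F] to the affine
    subspace [a + u *m B], where [B *m 'J F a = 1], and invert the
    restriction. *)
Lemma local_section m q (U : set 'rV[R]_m) (F : 'rV[R]_m -> 'rV[R]_q) a :
  open U -> smooth_on U F -> U a -> row_full ('J F a) ->
  exists (H : 'rV[R]_q -> 'rV[R]_m),
  [/\ smooth_near H (F a), H (F a) = a &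
      \forall y \near F a, U (H y) /\ F (H y) = y].
Proof.
move=> oU sF Ua /row_fullP [B BJ].
(* F \o l has the identity as differential at 0. *)
pose l (u : 'rV[R]_q) := a + u *m B.
have sl : smooth_on setT l by apply: smooth_affine; exact: openT.
have l0 : l 0 = a by rewrite /l mul0mx addr0.
have oU' : open (l @^-1` U).
  rewrite openE => x Ulx.
  have lx : {for x, continuous l} by exact: sl 0%N x I.
  by apply: lx; exact: open_nbhs_nbhs.
have sG : smooth_on (l @^-1` U) (F \o l).
  by apply: (smooth_comp oU' oU) => //; exact: smooth_sub sl.
have Dl v : 'D_v l 0 = v *m B by exact: derive_affine.
have U0 : (l @^-1` U) 0 by rewrite /= l0.
have dF : differentiable F (l 0) by rewrite l0; exact: smooth_differentiable sF Ua.
have dl : differentiable l 0 by exact: smooth_differentiable sl I.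
have DG v : 'D_v (F \o l) 0 = v.
  rewrite derive_comp // Dl -(mulmx_jacobian _ dF) l0 -mulmxA BJ.
  by rewrite mulmx1.
have [A [h [oA A0 sh h0 hP]]] := local_inverse oU' sG U0 DG.
rewrite /= l0 in A0 h0.
exists (l \o h); split.
- apply: smooth_near_comp; first by exists A.
  by exists setT; split=> //; exact: openT.
- by rewrite /= h0.
- have : nbhs (F a) A by exact: open_nbhs_nbhs.
  by apply: filterS => y /hP.
Qed.

End SmoothNear.

(** * Smooth maps between manifolds *)

Section Charts.
Context {R : realType} {n : nat} {M : manifold R n}.
Implicit Types x p : M.

Lemma near_chart_inv x p (P : set M) : chart_dom x p -> nbhs p P ->
  \forall u \near chart x p, P (chart_inv x u).
Proof.
move=> xp pP.
have Cu : (chart x @` chart_dom x) (chart x p) by exists p.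
have := chart_inv_continuous Cu; rewrite /prop_for /continuous_at chartK //.
exact.
Qed.

Lemma near_chart_dom x p : chart_dom x p -> nbhs p (chart_dom x).
Proof. by move=> xp; apply: open_nbhs_nbhs; split=> //; exact: chart_dom_open. Qed.

Lemma near_chartK x p : chart_dom x p ->
  \forall u \near chart x p, chart x (chart_inv x u) = u.
Proof.
move=> xp; have : nbhs (chart x p) (chart x @` chart_dom x).
  by apply: open_nbhs_nbhs; split; [exact: chart_codom_open|exists p].
by apply: filterS => _ [y xy <-]; rewrite chartK.
Qed.

Lemma chart_image_open x (A : set M) : open A ->
  open (chart x @` (chart_dom x `&` A)).
Proof.
move=> oA; rewrite openE => _ [p [xp Ap] <-].
have nA : nbhs p (chart_dom x `&` A).
  by apply: filterI; [exact: near_chart_dom|exact: open_nbhs_nbhs].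
apply: filterS2 (near_chart_inv xp nA) (near_chartK xp) => u Au <-.
by exists (chart_inv x u).
Qed.

Lemma transition_smooth_near x y p : chart_dom x p -> chart_dom y p ->
  smooth_near (chart y \o chart_inv x) (chart x p).
Proof.
move=> xp yp; exists (chart x @` (chart_dom x `&` chart_dom y)); split.
- exact/chart_image_open/chart_dom_open.
- by exists p.
- exact: chart_smooth.
Qed.

End Charts.

Section SmoothMaps.
Context {R : realType}.

(** The expression of [phi] in the designated charts at [p] and at [phi p]. Its
    Jacobian at [chart p p] is by definition [tangent phi p]. *)
Definition local_rep m n (M : manifold R m) (N : manifold R n) (phi : M -> N)
    (p : M) : 'rV[R]_m -> 'rV[R]_n :=
  chart (phi p) \o phi \o chart_inv p.

Lemma local_rep_center m n (M : manifold R m) (N : manifold R n)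
    (phi : M -> N) p :
  local_rep phi p (chart p p) = chart (phi p) (phi p).
Proof. by rewrite /local_rep /= chartK //; exact: chart_dom_center. Qed.

(** Smoothness can be tested in the designated charts only: in any other pair of
    charts the expression of [phi] differs from [local_rep phi p] by transition
    maps on both sides. *)
Lemma smooth_mapP m n (M : manifold R m) (N : manifold R n) (phi : M -> N) :
  smooth_map phi <->
  continuous phi /\ forall p, smooth_near (local_rep phi p) (chart p p).
Proof.
split=> [[cphi sphi]|[cphi sphi]]; split=> //.
  move=> p; exists (chart p @` (chart_dom p `&` phi @^-1` chart_dom (phi p))).
  split; last exact: sphi.
    apply: chart_image_open; apply: open_comp; last exact: chart_dom_open.
    by move=> ? _; exact: cphi.
  by exists p => //; split; exact: chart_dom_center.
move=> x y; apply: smooth_near_on => _ [p [xp yphip] <-].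
have pp := chart_dom_center p; have qq := chart_dom_center (phi p).
apply: (@smooth_near_eq _ _ _ ((chart y \o chart_inv (phi p)) \o
    (local_rep phi p \o (chart p \o chart_inv x)))).
  have nD : nbhs p (chart_dom p `&` phi @^-1` chart_dom (phi p)).
    apply: filterI; first exact: near_chart_dom.
    exact/cphi/near_chart_dom.
  apply: filterS (near_chart_inv xp nD) => u [pu phipu] /=.
  by rewrite /local_rep /= chartK // chartK.
apply: smooth_near_comp.
  apply: smooth_near_comp; first exact: transition_smooth_near.
  by rewrite /= chartK //; exact: sphi.
rewrite /= chartK // local_rep_center; exact: transition_smooth_near.
Qed.

Lemma local_rep_comp m n k (M : manifold R m) (N : manifold R n)
    (P : manifold R k) (phi : M -> N) (psi : N -> P) p :
  continuous phi ->
  \forall u \near chart p p,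
    (local_rep psi (phi p) \o local_rep phi p) u = local_rep (psi \o phi) p u.
Proof.
move=> cphi; have pp := chart_dom_center p.
have nD : nbhs p (phi @^-1` chart_dom (phi p)).
  exact/cphi/near_chart_dom/chart_dom_center.
by apply: filterS (near_chart_inv pp nD) => u pu; rewrite /local_rep /= chartK.
Qed.

Lemma smooth_map_comp m n k (M : manifold R m) (N : manifold R n)
    (P : manifold R k) (phi : M -> N) (psi : N -> P) :
  smooth_map phi -> smooth_map psi -> smooth_map (psi \o phi).
Proof.
move=> /smooth_mapP [cphi sphi] /smooth_mapP [cpsi spsi]; apply/smooth_mapP.
split=> [x|p]; first by apply: continuous_comp; [exact: cphi|exact: cpsi].
apply: (@smooth_near_eq _ _ _ (local_rep psi (phi p) \o local_rep phi p)).
  exact: local_rep_comp.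
by apply: smooth_near_comp => //; rewrite local_rep_center.
Qed.

Lemma tangent_comp m n k (M : manifold R m) (N : manifold R n)
    (P : manifold R k) (phi : M -> N) (psi : N -> P) p :
  smooth_map phi -> smooth_map psi ->
  tangent (psi \o phi) p = tangent phi p *m tangent psi (phi p).
Proof.
move=> /smooth_mapP [cphi sphi] /smooth_mapP [cpsi spsi].
have dphi := smooth_near_differentiable (sphi p).
have dpsi := smooth_near_differentiable (spsi (phi p)).
rewrite -local_rep_center in dpsi.
have E := jacobian_comp dphi dpsi; rewrite local_rep_center in E.
have D := differentiable_comp dphi dpsi.
have E1 := near_jacobian (local_rep_comp psi p cphi) D.
rewrite /tangent -/(local_rep phi p) -/(local_rep psi (phi p)) -/(local_rep (psi \o phi) p).
by rewrite -E1.
Qed.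

(** Maps out of the base of a surjective submersion are smooth as soon as their
    pullback is: locally [j] is [F] composed with a smooth section of [pr]. *)
Lemma submersion_factor_smooth s q n (S : manifold R s) (Q : manifold R q)
    (N : manifold R n) (pr : S -> Q) (F : S -> N) (j : Q -> N) :
  surjective_submersion pr -> smooth_map F ->
  (forall x, j (pr x) = F x) -> smooth_map j.
Proof.
move=> [spr surj sub] /smooth_mapP [cF sF] jpr.
have [cpr lpr] := spr.
suff key y : smooth_near (local_rep j y) (chart y y) /\ {for y, continuous j}.
  by apply/smooth_mapP; split=> y; have [] := key y.
have [p <-] := surj y; have pp := chart_dom_center p.
pose D := pr @^-1` chart_dom (pr p) `&` F @^-1` chart_dom (F p).
have oD : open D.
  apply: openI; apply: open_comp; try exact: chart_dom_open.
    by move=> ? _; exact: cpr.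
  by move=> ? _; exact: cF.
have Dp : D p by split; exact: chart_dom_center.
pose U := chart p @` (chart_dom p `&` D).
have oU : open U by exact: chart_image_open.
have Up : U (chart p p) by exists p.
have sU : smooth_on U (local_rep pr p).
  by apply: smooth_sub (lpr p (pr p)) => _ [z [pz [Dz _]] <-]; exists z.
have [H []] := local_section oU sU Up (sub p).
rewrite local_rep_center => sH Hc HU.
(* In charts, j is F composed with the local section H of pr. *)
have jE : \forall u \near chart (pr p) (pr p),
    F (chart_inv p (H u)) = j (chart_inv (pr p) u).
  apply: filterS HU => u [[z [pz [prz _]] zE] Hu].
  by rewrite -zE chartK // -jpr -Hu -zE /local_rep /= chartK // chartK.
split.
  apply: (@smooth_near_eq _ _ _ (local_rep F p \o H)).
    by apply: filterS jE => u /= Eu; rewrite /local_rep /= Eu jpr.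
  by apply: smooth_near_comp => //; rewrite Hc; exact: sF.
have qq := chart_dom_center (pr p).
have cj : {for pr p, continuous (F \o chart_inv p \o H \o chart (pr p))}.
  apply: continuous_comp; first exact: chart_continuous.
  apply: continuous_comp; first exact: smooth_near_continuous.
  rewrite Hc; apply: continuous_comp.
    by apply: chart_inv_continuous; exists p.
  exact: cF.
have nj : \forall y \near pr p, F (chart_inv p (H (chart (pr p) y))) =
    j (chart_inv (pr p) (chart (pr p) y)).
  exact: chart_continuous qq _ jE.
rewrite /prop_for /continuous_at.
have -> : j (pr p) = (F \o chart_inv p \o H \o chart (pr p)) (pr p).
  by rewrite /= Hc chartK // jpr.
apply: cvg_trans cj; apply: near_eq_cvg.
apply: filterS2 nj (near_chart_dom qq) => z /= Ez zq.
by rewrite Ez chartK.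
Qed.

End SmoothMaps.

(** * Leaves and differentials of functions *)

(** A smooth map whose differential sends [K] into [K'] sends leaves of [K] into
    leaves of [K'], because it sends curves tangent to [K] to curves tangent to
    [K']. *)
Section Leaves.
Context {R : realType} {m n : nat} {M : manifold R m} {N : manifold R n}.
Variables (J : M -> N) (K : M -> set 'rV[R]_m) (K' : N -> set 'rV[R]_n).
Hypothesis sJ : smooth_map J.
Hypothesis JK : forall x v, K x v -> K' (J x) (v *m tangent J x).

Lemma tangent_curve_comp (c : R -> M) :
  tangent_curve K c -> tangent_curve K' (J \o c).
Proof.
move=> [cc sc Kc]; have /smooth_mapP [cJ lJ] := sJ.
have scc t : smooth_near (chart (c t) \o c) t.
  exists (c @^-1` chart_dom (c t)); split; last exact: sc.
    by apply: open_comp; [move=> ? _; exact: cc|exact: chart_dom_open].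
  exact: chart_dom_center.
have near_c t : \forall u \near t,
    (local_rep J (c t) \o (chart (c t) \o c)) u = (chart (J (c t)) \o (J \o c)) u.
  have nc : \forall u \near t, chart_dom (c t) (c u).
    exact: cc t _ (near_chart_dom (chart_dom_center _)).
  by apply: filterS nc => u cu; rewrite /local_rep /= chartK.
have sJc t : smooth_near (local_rep J (c t) \o (chart (c t) \o c)) t.
  by apply: smooth_near_comp; [exact: scc|exact: lJ].
split=> [t|x|t].
- by apply: continuous_comp; [exact: cc|exact: cJ].
- apply: smooth_near_on => t xt.
  apply: (@smooth_near_eq _ _ _ ((chart x \o chart_inv (J (c t))) \o
    (local_rep J (c t) \o (chart (c t) \o c)))).
    have nD : \forall u \near t, chart_dom (J (c t)) (J (c u)).
      apply: (cc t (J @^-1` chart_dom (J (c t)))).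
      exact: cJ (c t) _ (near_chart_dom (chart_dom_center _)).
    apply: filterS2 (near_c t) nD => u /= -> ?.
    by rewrite chartK.
  apply: smooth_near_comp => //.
  rewrite /= local_rep_center; apply: transition_smooth_near => //.
  exact: chart_dom_center.
rewrite /= -(near_eq_derive _ (near_c t)).
have dc := smooth_near_differentiable (scc t).
have dJ := smooth_near_differentiable (lJ (c t)).
rewrite (derive_comp _ dc dJ) -(mulmx_jacobian _ dJ).
exact: JK.
Qed.

Lemma same_leaf_map x y : same_leaf K x y -> same_leaf K' (J x) (J y).
Proof.
move=> [c [tc <- <-]]; exists (J \o c); split=> //.
exact: tangent_curve_comp.
Qed.

End Leaves.

Section Functions.
Context {R : realType}.

(** The chain rule; multiplication by the tangent matrix on the left pulls
    covectors back, as they are columns. *)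
Lemma diff_fun_comp m n (M : manifold R m) (N : manifold R n) (phi : M -> N)
    (f : N -> R) p :
  smooth_map phi -> smooth_fun f ->
  diff_fun (f \o phi) p = tangent phi p *m diff_fun f (phi p).
Proof.
move=> /smooth_mapP [cphi sphi] sf; apply/colP => i.
have qq := chart_dom_center (phi p).
have df : differentiable (fun_rep f (phi p)) (local_rep phi p (chart p p)).
  rewrite local_rep_center; apply: smooth_differentiable (sf (phi p)) _.
  by exists (phi p).
have dphi := smooth_near_differentiable (sphi p).
have near_f : \forall u \near chart p p,
    (fun_rep f (phi p) \o local_rep phi p) u = fun_rep (f \o phi) p u.
  have nD : nbhs p (phi @^-1` chart_dom (phi p)).
    exact/cphi/near_chart_dom.
  apply: filterS (near_chart_inv (chart_dom_center p) nD) => u pu.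
  by rewrite /fun_rep /local_rep /= chartK.
rewrite mxE -(near_eq_derive _ near_f) (derive_comp _ dphi df).
rewrite (derive_rVE _ df) mxE; apply: eq_bigr => j _.
rewrite [X in _ = _ * X]mxE local_rep_center; congr (_ * _).
by rewrite -(row_jacobian i dphi) mxE.
Qed.

End Functions.

(** * Linear reduction of Dirac structures *)

Section LinearDirac.
Context {R : realType}.

Lemma mem_graph_form n (A : 'M[R]_n) v w :
  ((v, w) \in graph_form A) = (w == (v *m A)^T).
Proof.
pose f (v : 'rV[R]_n) := (v, (v *m A)^T).
have lf : linear f by move=> a x y; rewrite /f mulmxDl linearD /= -scalemxAl linearZ.
pose g : {linear 'rV[R]_n -> ('rV[R]_n * 'cV[R]_n)%type} :=
  HB.pack f (GRing.isLinear.Build R _ _ _ f lf).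
apply/memv_imgP/eqP => [[u _]|->].
  by rewrite (lfunE g) => -[-> ->].
by exists v; rewrite ?memvf // (lfunE g).
Qed.

Lemma mem_graph_bivector n (P : 'M[R]_n) v w :
  ((v, w) \in graph_bivector P) = (v == (P *m w)^T).
Proof.
pose f (w : 'cV[R]_n) := ((P *m w)^T, w).
have lf : linear f by move=> a x y; rewrite /f mulmxDr linearD /= -scalemxAr linearZ.
pose g : {linear 'cV[R]_n -> ('rV[R]_n * 'cV[R]_n)%type} :=
  HB.pack f (GRing.isLinear.Build R _ _ _ f lf).
apply/memv_imgP/eqP => [[u _]|->].
  by rewrite (lfunE g) => -[-> ->].
by exists w; rewrite ?memvf // (lfunE g).
Qed.

Lemma row_full_mulmxI m n k (A : 'M[R]_(m, n)) (B C : 'M[R]_(n, k)) :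
  row_full A -> A *m B = A *m C -> B = C.
Proof.
by move=> /row_fullP [A' A'A] E; rewrite -[B]mul1mx -A'A -mulmxA E mulmxA A'A mul1mx.
Qed.

Lemma row_full_factor m n k (A : 'M[R]_(m, n)) (B : 'M[R]_(k, n)) :
  row_full A -> exists C, B = C *m A.
Proof.
by move=> /row_fullP [A' A'A]; exists (B *m A'); rewrite -mulmxA A'A mulmx1.
Qed.

End LinearDirac.

(** The commutative square of differentials at a point: [T] and [t] are those of
    a leg and of the induced map, [P] and [P1] those of the two projections. *)
Section LinearReduction.
Context {R : realType} {s m q q1 : nat}.
Variables (A : 'M[R]_s) (T : 'M[R]_(s, m)) (P : 'M[R]_(s, q)).
Variables (P1 : 'M[R]_(m, q1)) (t : 'M[R]_(q, q1)).
Variable L : {vspace 'rV[R]_m * 'cV[R]_m}.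
Hypothesis Pt : P *m t = T *m P1.
Hypothesis TL : forward T (graph_form A) = [set a | a \in L].

(** Following a covector [nu] through the two push-forwards: the vector
    [pi *m nu] lifts to some [v] with [v *m A = (T *m P1 *m nu)^T], and as
    [A = P *m Ared *m P^T] with [P] of full rank, [v *m P] is determined by
    [v *m P *m Ared = (t *m nu)^T]. *)
Lemma reduced_bivector (Ared : 'M[R]_q) (pi : 'M[R]_q1) :
  row_full P -> P *m Ared *m P^T = A -> Ared \in unitmx ->
  forward P1 L = [set a | a \in graph_bivector pi] ->
  t^T *m (invmx Ared)^T *m t = pi.
Proof.
move=> fP PA uA P1L; apply: trmx_inj; apply/row_matrixP => i; rewrite -!tr_col !colE.
set nu := delta_mx i 0.
have : ((pi *m nu)^T, nu) \in graph_bivector pi by rewrite mem_graph_bivector.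
rewrite -[is_true _]/([set a | a \in graph_bivector pi] ((pi *m nu)^T, nu)) -P1L.
move=> [x /= [xE xL]].
have : [set a | a \in L] (x, P1 *m nu) by [].
rewrite -TL => -[v /= [vx]]; rewrite mem_graph_form => /eqP vE.
have {vE} : P *m (t *m nu) = P *m (v *m P *m Ared)^T.
  by rewrite mulmxA Pt -mulmxA vE -PA !trmx_mul trmxK !mulmxA.
move=> /(row_full_mulmxI fP) vE.
rewrite -xE -vx -[RHS]mulmxA -Pt -[X in X^T]mulmxA vE -!trmx_mul trmxK.
by rewrite !mulmxA mulmxK.
Qed.

(** The kernel of the induced map is the image of [ker T] under [P]: if
    [u *m T] lies in the kernel of [L], it is also [x *m T] for some [x] in the
    kernel of [A]. *)
Lemma reduced_kernel (u : 'rV[R]_s) :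
  (forall v, (v, 0) \in L <-> v *m P1 = 0) ->
  (forall v : 'rV_s, v *m A = 0 <-> v *m P = 0) ->
  u *m P *m t = 0 <-> (u <= kermx T + kermx A)%MS.
Proof.
move=> kL kA; rewrite -mulmxA Pt mulmxA; split.
  move=> /kL uL; have : [set a | a \in L] (u *m T, 0) by [].
  rewrite -TL => -[x /= [xT]]; rewrite mulmx0 mem_graph_form => /eqP xA.
  rewrite -[u](subrK x); apply: addmx_sub_adds; apply/sub_kermxP.
    by rewrite mulmxBl xT subrr.
  by apply: trmx_inj; rewrite -xA trmx0.
move=> /sub_addsmxP [[a b] /= ->].
rewrite 2!mulmxDl -(mulmxA a) mulmx_ker mulmx0 mul0mx add0r; apply/kL.
have : forward T (graph_form A) (b *m kermx A *m T, 0).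
  exists (b *m kermx A); split=> //.
  by rewrite /= mulmx0 mem_graph_form -mulmxA mulmx_ker mulmx0 trmx0.
by rewrite TL.
Qed.

End LinearReduction.

Section ReducedOrthogonal.
Context {R : realType}.

Lemma mulmx_tr_sub m n p k (X : 'M[R]_(m, n)) (W : 'M[R]_(p, n))
    (W' : 'M[R]_(k, n)) :
  (W <= W')%MS -> X *m W'^T = 0 -> X *m W^T = 0.
Proof. by move=> /submxP [D ->] h; rewrite trmx_mul mulmxA h mul0mx. Qed.

(** Since [ker t2] is the image of [ker T2] under [P], a vector [u *m P] is
    orthogonal to [ker t2] for [Ared] exactly when [u] is orthogonal to [ker T2]
    for [A], that is, when [u] lies in [ker T1 + ker A]. *)
Lemma reduced_orth s m1 m2 q q1 q2 (A : 'M[R]_s) (Ared : 'M[R]_q)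
    (P : 'M[R]_(s, q)) (T1 : 'M[R]_(s, m1)) (T2 : 'M[R]_(s, m2))
    (t1 : 'M[R]_(q, q1)) (t2 : 'M[R]_(q, q2)) :
  row_full P -> P *m Ared *m P^T = A ->
  (forall v : 'rV_s, v *m A = 0 <-> v *m P = 0) ->
  (forall u : 'rV_s, u *m P *m t1 = 0 <-> (u <= kermx T1 + kermx A)%MS) ->
  (forall u : 'rV_s, u *m P *m t2 = 0 <-> (u <= kermx T2 + kermx A)%MS) ->
  (orth A (kermx T2) == kermx T1 + kermx A)%MS ->
  (kermx t1 == orth Ared (kermx t2))%MS.
Proof.
move=> fP PA kA k1 k2 /eqmxP oA.
have AP0 : kermx A *m P = 0.
  apply/row_matrixP => i; rewrite row_mul row0; apply/kA.
  by rewrite -row_mul mulmx_ker row0.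
have le1 : (kermx t2 <= kermx T2 *m P)%MS.
  apply/rV_subP => w; have [u ->] := row_full_factor w fP.
  move=> /sub_kermxP /k2 /sub_addsmxP [[a b] /= ->].
  rewrite mulmxDl -(mulmxA b) AP0 mulmx0 addr0 -mulmxA.
  exact: submxMl.
have le2 : (kermx T2 *m P <= kermx t2)%MS.
  apply/sub_kermxP/row_matrixP => i; rewrite row0 2!row_mul; apply/k2.
  exact: (submx_trans (row_sub i _) (addsmxSl _ _)).
have key (u : 'rV_s) : u *m P *m t1 = 0 <->
    u *m P *m Ared *m (kermx t2)^T = 0.
  rewrite k1 -oA /orth sub_kermx -PA !mulmxA; split.
    move=> /eqP h; apply: mulmx_tr_sub le1 _.
    by rewrite trmx_mul mulmxA.
  move=> h; apply/eqP; have := mulmx_tr_sub le2 h.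
  by rewrite trmx_mul mulmxA.
apply/andP; split; apply/rV_subP => v; have [u ->] := row_full_factor v fP;
  rewrite /orth !sub_kermx => /eqP h; apply/eqP; move: h.
  by move=> /key; rewrite !mulmxA.
by rewrite mulmxA => /key.
Qed.

End ReducedOrthogonal.

(** * The induced maps between leaf spaces *)

Section Quotients.
Context {R : realType}.

Lemma submersion_factor s q n (S : manifold R s) (Q : manifold R q)
    (N : manifold R n) (pr : S -> Q) (F : S -> N) (j : Q -> N) :
  surjective_submersion pr -> surjective_submersion F ->
  (forall x, j (pr x) = F x) -> surjective_submersion j.
Proof.
move=> spr [sF surjF subF] jE; have sj := submersion_factor_smooth spr sF jE.
have [smooth_pr surj _] := spr; split=> // [z|y].
  by have [x xz] := surjF z; exists (pr x); rewrite jE.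
have [x <-] := surj y.
have jprE : j \o pr = F by apply/funext.
have := subF x; rewrite -jprE (tangent_comp _ smooth_pr sj).
move=> /row_fullP [B BE]; apply/row_fullP; exists (B *m tangent pr x).
by rewrite -mulmxA.
Qed.

Lemma surjective_submersion_comp m n k (M : manifold R m) (N : manifold R n)
    (P : manifold R k) (phi : M -> N) (psi : N -> P) :
  surjective_submersion phi -> surjective_submersion psi ->
  surjective_submersion (psi \o phi).
Proof.
move=> [sphi surjphi subphi] [spsi surjpsi subpsi]; split.
- exact: smooth_map_comp.
- by move=> z; have [y <-] := surjpsi z; have [x <-] := surjphi y; exists x.
move=> x; rewrite tangent_comp //.
have /row_fullP [B BE] := subphi x; have /row_fullP [C CE] := subpsi (phi x).
by apply/row_fullP; exists (C *m B); rewrite mulmxA -(mulmxA C) BE mulmx1.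
Qed.

(** One leg [J : S -> M] of the pair, and the map [j] it induces between the
    leaf spaces. *)
Section OneLeg.
Context {s m q q1 : nat} {S : manifold R s} {M : manifold R m}.
Context {Q : manifold R q} {Q1 : manifold R q1}.
Variables (Omega : S -> 'M[R]_s) (L : M -> {vspace 'rV[R]_m * 'cV[R]_m}).
Variables (J : S -> M) (pr : S -> Q) (pr1 : M -> Q1).
Variables (Omega_red : Q -> 'M[R]_q) (pi1 : Q1 -> 'M[R]_q1).
Hypothesis dJ : dirac_map (fun x => graph_form (Omega x)) L J.
Hypothesis sJ : surjective_submersion J.
Hypothesis spr : simple_foliation (fun x => char_kernel (graph_form (Omega x))) pr.
Hypothesis spr1 : simple_foliation (fun x => char_kernel (L x)) pr1.

Lemma char_kernel_graph x (v : 'rV[R]_s) : v *m Omega x = 0 <-> v *m tangent pr x = 0.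
Proof.
have [_ _ <-] := spr; rewrite /char_kernel /= mem_graph_form.
split=> [->|/eqP E]; first by rewrite trmx0.
by apply: trmx_inj; rewrite -E trmx0.
Qed.

Lemma char_kernel_push x v : char_kernel (graph_form (Omega x)) v ->
  char_kernel (L (J x)) (v *m tangent J x).
Proof.
move=> kv; have : forward (tangent J x) (graph_form (Omega x)) (v *m tangent J x, 0).
  by exists v; rewrite /= mulmx0.
by rewrite dJ.2.
Qed.

(** [J] sends leaves to leaves, so [pr1 \o J] can be evaluated on any point of
    the fibre of [pr]. *)
Lemma quotient_map_exists : exists j : Q -> Q1, forall x, j (pr x) = pr1 (J x).
Proof.
have [[_ surj _] prP _] := spr; have [_ pr1P _] := spr1.
have [sigma sigmaP] := choice surj; exists (fun y => pr1 (J (sigma y))) => x.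
apply/pr1P; apply: (same_leaf_map dJ.1 char_kernel_push).
exact/prP/sigmaP.
Qed.

Variable j : Q -> Q1.
Hypothesis jE : forall x, j (pr x) = pr1 (J x).

Lemma quotient_map_submersion : surjective_submersion j.
Proof.
have [s_pr _ _] := spr; have [s_pr1 _ _] := spr1.
exact: submersion_factor s_pr (surjective_submersion_comp sJ s_pr1) jE.
Qed.

Lemma tangent_quotient x :
  tangent pr x *m tangent j (pr x) = tangent J x *m tangent pr1 (J x).
Proof.
have [[s_pr _ _] _ _] := spr; have [[s_pr1 _ _] _ _] := spr1.
have [s_j _ _] := quotient_map_submersion; have [s_J _ _] := sJ.
have jprE : j \o pr = pr1 \o J by exact/funext.
have := tangent_comp x s_pr s_j; rewrite jprE => <-.
exact: tangent_comp.
Qed.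

Lemma quotient_kernel x (u : 'rV[R]_s) :
  u *m tangent pr x *m tangent j (pr x) = 0 <->
  (u <= kermx (tangent J x) + kermx (Omega x))%MS.
Proof.
apply: (reduced_kernel (tangent_quotient x) (dJ.2 x)).
  by have [_ _ h] := spr1; exact: h.
exact: char_kernel_graph.
Qed.

Lemma quotient_poisson :
  induced_symplectic pr Omega Omega_red -> induced_poisson pr1 L pi1 ->
  poisson_map (symplectic_bivector Omega_red) pi1 j.
Proof.
move=> [[_ uO] OE] [_ [_ pr1L]].
have [s_j _ _] := quotient_map_submersion; split=> // f g sf sg y.
have [[_ surj sub] _ _] := spr; have [x <-] := surj y.
have pr1L_x := pr1L (J x); rewrite -jE in pr1L_x.
have piE := reduced_bivector (tangent_quotient x) (dJ.2 x) (sub x) (OE x)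
  (uO _) pr1L_x.
rewrite /poisson_bracket (diff_fun_comp (pr x) s_j sf).
rewrite (diff_fun_comp (pr x) s_j sg) -piE.
set t := tangent j (pr x); set df := diff_fun f _; set dg := diff_fun g _.
by rewrite (trmx_mul t df) !mulmxA.
Qed.

End OneLeg.
End Quotients.

Theorem theorem3p5 (R : realType) (s m1 m2 : nat)
    (S : manifold R s) (M1 : manifold R m1) (M2 : manifold R m2)
    (Omega : S -> 'M[R]_s)
    (L1 : M1 -> {vspace 'rV[R]_m1 * 'cV[R]_m1})
    (L2 : M2 -> {vspace 'rV[R]_m2 * 'cV[R]_m2})
    (J1 : S -> M1) (J2 : S -> M2)
    (q q1 q2 : nat)
    (Q : manifold R q) (Q1 : manifold R q1) (Q2 : manifold R q2)
    (pr : S -> Q) (pr1 : M1 -> Q1) (pr2 : M2 -> Q2)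
    (Omega_red : Q -> 'M[R]_q) (pi1 : Q1 -> 'M[R]_q1) (pi2 : Q2 -> 'M[R]_q2) :
  pre_dual_pair Omega L1 L2 J1 J2 ->
  full J1 J2 ->
  simple_foliation (fun x => char_kernel (graph_form (Omega x))) pr ->
  simple_foliation (fun x => char_kernel (L1 x)) pr1 ->
  simple_foliation (fun x => char_kernel (L2 x)) pr2 ->
  induced_symplectic pr Omega Omega_red ->
  induced_poisson pr1 L1 pi1 ->
  induced_poisson pr2 L2 pi2 ->
  exists (j1 : Q -> Q1) (j2 : Q -> Q2),
    [/\ forall x, j1 (pr x) = pr1 (J1 x),
        forall x, j2 (pr x) = pr2 (J2 x),
        dual_pair Omega_red pi1 pi2 j1 j2 &
        full j1 j2].
Proof.
move=> [_ _ dJ1 dJ2 orthJ] [sJ1 sJ2] spr spr1 spr2 hO hpi1 hpi2.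
have [j1 j1E] := quotient_map_exists dJ1 spr spr1.
have [j2 j2E] := quotient_map_exists dJ2 spr spr2.
exists j1, j2; split=> //; last first.
  by split; [exact: (quotient_map_submersion sJ1 spr spr1 j1E)
            |exact: (quotient_map_submersion sJ2 spr spr2 j2E)].
split.
- exact: hO.1.
- by split; [exact: hpi1.1|exact: hpi2.1].
- exact: (quotient_poisson dJ1 sJ1 spr spr1 j1E hO hpi1).
- exact: (quotient_poisson dJ2 sJ2 spr spr2 j2E hO hpi2).
move=> y; have [[_ surj sub] _ _] := spr; have [x <-] := surj y.
apply: (reduced_orth (sub x) (hO.2 x) (char_kernel_graph spr x)
  (quotient_kernel dJ1 sJ1 spr spr1 j1E x) (quotient_kernel dJ2 sJ2 spr spr2 j2E x)).
exact: (orthJ x).2.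
Qed.
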